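(* For any positive integer $n$, there exists a symmetric connected quandle of order $6n$ that is not involutory.
   Context: A quandle is a non-empty set $X$ with a binary operation $*$ such that: (1) $a*a=a$ for all $a\in X$; (2) for all $b,c\in X$ there is a unique $a\in X$ with $a*b=c$; (3) $(a*b)*c=(a*c)*(b*c)$ for all $a,b,c\in X$. For $a\in X$, the right translation $\mathcal{R}_a:X\to X$, $\mathcal{R}_a(x)=x*a$, is a permutation of $X$. The quandle $X$ is connected if the subgroup of $\mathrm{Sym}(X)$ generated by all $\mathcal{R}_a$ ($a\in X$) acts transitively on $X$; it is involutory (a kei) if $\mathcal{R}_a^2=\mathrm{id}$ for all $a\in X$. Write $x\mathbin{\bar{*}}y=\mathcal{R}_y^{-1}(x)$. A good involution on $(X,* )$ is a map $\rho:X\to X$ with $\rho^2=\mathrm{id}$ such that $x*\rho(y)=x\mathbin{\bar{*}}y$ and $\rho(x*y)=\rho(x)*y$ for all $x,y\in X$. A symmetric quandle is a quandle with a good involution. *)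

(* Defs.v *)
From mathcomp Require Import all_boot all_fingroup.

Set Implicit Arguments.
Unset Strict Implicit.
Unset Printing Implicit Defensive.

Local Open Scope group_scope.

(* Only finite quandles are needed; [Q x y] stands for x * y. *)
Record quandle (X : finType) := Quandle {
  qop :> X -> X -> X;
  quandle_nonempty : (0 < #|X|)%N;
  quandle_idem : forall a, qop a a = a;
  quandle_div : forall b c, exists! a, qop a b = c;
  quandle_dist : forall a b c, qop (qop a b) c = qop (qop a c) (qop b c)
}.

Section QuandleTheory.

Variables (X : finType) (Q : quandle X).

Lemma rtrans_inj (a : X) : injective (fun x => Q x a).
Proof.
move=> x y exy; have [z [_ zuniq]] := quandle_div Q a (Q y a).
by rewrite -(zuniq x exy) (zuniq y erefl).
Qed.

Definition rtrans (a : X) : {perm X} := perm (@rtrans_inj a).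

Definition qbar (x y : X) : X := (rtrans y)^-1 x.

Definition inner_group : {group {perm X}} :=
  <<[set rtrans a | a : X]>>%G.

Definition connected_quandle : bool :=
  [transitive inner_group, on [set: X] | 'P].

Definition involutory_quandle : Prop := forall a : X, rtrans a ^+ 2 = 1.

Definition good_involution (rho : X -> X) : Prop :=
  [/\ forall x, rho (rho x) = x,
      forall x y, Q x (rho y) = qbar x y
    & forall x y, rho (Q x y) = Q (rho x) y].

Definition symmetric_quandle : Prop := exists rho, good_involution rho.

End QuandleTheory.

(* Main.v *)
Require Import Defs.
From mathcomp Require Import all_boot all_fingroup.
From mathcomp Require Import all_algebra.
From mathcomp Require Import ring.

(** The witness is a Galkin quandle, an extension of the three-element dihedral
    quandle [x * y = 2 y - x] on Z/3 by the additive group of a finite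
    commutative ring [A] with a base point [c].  It lives on [Z/3 x A], with
      [(x, a) * (y, b) = (2 y - x, - a + mu (x - y) b + tau (x - y))],
    where [mu] is the sequence 2, -1, -1 and [tau] is [c] at -1 and 0 elsewhere.

    Since [mu d] behaves like twice the cosine of [2 pi d / 3], it satisfies the
    product formula [mu_mul], which is what self-distributivity asks of the
    coefficient of the third argument; [tau_cocycle] is the corresponding
    condition on the constant terms.

    The square of a right translation keeps the base coordinate and shifts the
    fibre coordinate by [tau (- d) - tau d], which is [c] for [d = 1].  So the
    quandle is not involutory as soon as [c] is nonzero.  If moreover [2 c = 0],
    this shift is [mu d * c] for every [d], exactly the effect of replacing the
    acting element [(y, b)] by [(y, b + c)]; hence translation of the fibres by
    [c] is a good involution ([galkin_good_involution]).

    Because [mu] takes the value -1 off 0, one right translation already carries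
    any point to any point of another fibre, which gives connectedness.

    For order [6 n] the choice is [A = Z/2n] and [c = n], the element of
    additive order two. *)

Set Implicit Arguments.
Unset Strict Implicit.
Unset Printing Implicit Defensive.

Import GRing.Theory.
Local Open Scope ring_scope.

Section Galkin.

Variables (A : finComNzRingType) (c : A).

Implicit Types (d u v : 'Z_3) (p q : 'Z_3 * A).

Definition mu d : A := if d == 0 then 2%:R else -1.

Definition tau d : A := if d == -1 then c else 0.

Definition galkin_op p q : 'Z_3 * A :=
  (q.1 *+ 2 - p.1, - p.2 + mu (p.1 - q.1) * q.2 + tau (p.1 - q.1)).

Lemma Z3_ind (P : 'Z_3 -> Prop) : P 0 -> P 1 -> P (-1) -> forall d, P d.
Proof.
move=> P0 P1 P2 [[|[|[|//]]] lt_d3].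
- by rewrite (_ : Ordinal _ = 0) //; apply: val_inj.
- by rewrite (_ : Ordinal _ = 1) //; apply: val_inj.
- by rewrite (_ : Ordinal _ = -1) //; apply: val_inj.
Qed.

Lemma Z3_mulr2 d : d *+ 2 = - d.
Proof. by elim/Z3_ind: d; apply: val_inj. Qed.

Lemma muN d : mu (- d) = mu d.
Proof. by rewrite /mu oppr_eq0. Qed.

(** The product-to-sum formula for cosines, for the period-three sequence
    [2 cos (2 pi d / 3)]. *)
Lemma mu_mul u v : mu u * mu v = mu (u + v) + mu (v - u).
Proof. by elim/Z3_ind: u; elim/Z3_ind: v; rewrite /mu /=; ring. Qed.

(** The condition that self-distributivity puts on the constant terms: here [u]
    and [v] are the base differences of the first two and of the last two
    arguments. *)
Lemma tau_cocycle u v :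
  tau (v - u) - tau u = tau (- u) + mu u * tau v - tau (u + v).
Proof. by elim/Z3_ind: u; elim/Z3_ind: v; rewrite /mu /tau /=; ring. Qed.

Lemma galkin_idem p : galkin_op p p = p.
Proof.
case: p => x a; rewrite /galkin_op /= subrr /mu /tau /=.
by congr pair; ring.
Qed.

Definition galkin_div p q : 'Z_3 * A :=
  (q.1 *+ 2 - p.1, - p.2 + mu (p.1 - q.1) * q.2 + tau (q.1 - p.1)).

(** Acting by [q] reflects the base difference [d] to [- d]; this is why division
    has [tau (- d)] where the operation has [tau d]. *)
Lemma galkin_opK q : cancel (galkin_op^~ q) (galkin_div^~ q).
Proof.
case: q => y b [x a]; rewrite /galkin_op /galkin_div /=.
have -> : y *+ 2 - x - y = - (x - y) by ring.
have -> : y - (y *+ 2 - x) = x - y by ring.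
by rewrite muN; congr pair; ring.
Qed.

Lemma galkin_divK q : cancel (galkin_div^~ q) (galkin_op^~ q).
Proof.
case: q => y b [x a]; rewrite /galkin_op /galkin_div /=.
have -> : y *+ 2 - x - y = - (x - y) by ring.
rewrite muN -[y - x]opprB.
by congr pair; ring.
Qed.

Lemma galkin_div_unique q r : exists! p, galkin_op p q = r.
Proof.
exists (galkin_div r q); split; first exact: galkin_divK.
by move=> p <-; rewrite galkin_opK.
Qed.

Lemma galkin_dist p q r :
  galkin_op (galkin_op p q) r = galkin_op (galkin_op p r) (galkin_op q r).
Proof.
case: p q r => [x a] [y b] [z e]; rewrite /galkin_op /=.
(* Only the base differences [u = x - y] and [v = y - z] matter. *)
have -> : x - z = (x - y) + (y - z) by ring.
have -> : y *+ 2 - x - z = (y - z) - (x - y) by ring.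
have -> : z *+ 2 - x - (z *+ 2 - y) = - (x - y) by ring.
rewrite muN; set u := x - y; set v := y - z.
congr pair; first by ring.
have -> : mu (v - u) = mu u * mu v - mu (u + v) by rewrite mu_mul; ring.
have -> : tau (v - u) = tau (- u) + mu u * tau v - tau (u + v) + tau u.
  by rewrite -tau_cocycle subrK.
by ring.
Qed.

Lemma galkin_nonempty : (0 < #|{: 'Z_3 * A}|)%N.
Proof. by apply/card_gt0P; exists 0. Qed.

Definition galkin : quandle ('Z_3 * A)%type :=
  Quandle galkin_nonempty galkin_idem galkin_div_unique galkin_dist.

(** The acting element must lie over the third point of Z/3; there the
    coefficient [mu] is -1, so its fibre coordinate can be solved for. *)
Lemma galkin_reach p q : p.1 != q.1 -> exists s, galkin p s = q.
Proof.
case: p q => [x a] [z e] /= neq_xz.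
exists (- (x + z), tau (z - x) - a - e); rewrite /= /galkin_op /=.
have -> : x - - (x + z) = z - x.
  by rewrite opprK addrA -mulr2n Z3_mulr2 addrC.
rewrite /mu subr_eq0 eq_sym (negbTE neq_xz); congr pair; last by ring.
by rewrite Z3_mulr2; ring.
Qed.

(** Two translations suffice, passing through a fibre other than those of the
    start and of the target. *)
Lemma galkin_connected : connected_quandle galkin.
Proof.
apply/imsetP; exists (0 : 'Z_3 * A) => //; apply/setP => q.
rewrite inE; apply/esym/orbitP.
have [w neq_0w neq_wq] : exists2 w : 'Z_3, 0 != w & w != q.1.
  by case: q => x a /=; elim/Z3_ind: x; [exists 1 | exists (-1) | exists 1].
have [s step1] := @galkin_reach 0 (w, 0) neq_0w.
have [t step2] := @galkin_reach (w, 0) q neq_wq.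
exists (rtrans galkin s * rtrans galkin t)%g.
  by rewrite groupM // mem_gen // imset_f.
by rewrite /= /aperm permM !permE step1 step2.
Qed.

(** [2 c = 0] makes the translation by [c] an involution, and it identifies the
    shift [tau (- d) - tau d] with [mu d * c]: both are 0 at 0 and [c]
    elsewhere. *)
Lemma galkin_good_involution :
  c *+ 2 = 0 -> good_involution galkin (fun p => (p.1, p.2 + c)).
Proof.
move=> c2; have cN : - c = c by apply/esym/eqP; rewrite -addr_eq0 -mulr2n c2.
split=> [[x a]|[x a] [y b]|[x a] [y b]] /=.
- by rewrite -addrA -mulr2n c2 addr0.
- apply: (@perm_inj _ (rtrans galkin (y, b))); rewrite permKV permE /=.
  rewrite -[RHS](galkin_divK (y, b)); congr galkin_op.
  rewrite /galkin_op /galkin_div /= -[y - x]opprB; congr pair.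
  move: (x - y) => d.
  have shift : tau (- d) = mu d * c + tau d.
    by elim/Z3_ind: d; rewrite /mu /tau /= ?mulr_natl ?c2 ?mulN1r ?cN
      ?addr0 // -mulr2n c2.
  by rewrite shift; ring.
- by rewrite /galkin_op /= opprD cN; congr pair; ring.
Qed.

Lemma galkin_not_involutory : c != 0 -> ~ involutory_quandle galkin.
Proof.
move=> c_neq0 /(_ 0) /permP /(_ (1, 0)).
rewrite expgS expg1 permM !permE /= /galkin_op /mu /tau /= => -[cE].
by case/eqP: c_neq0; rewrite -[RHS]cE; ring.
Qed.

End Galkin.

Theorem proposition5p13 (n : nat) (hn : (0 < n)%N) :
  exists (X : finType) (Q : quandle X),
    [/\ #|X| = (6 * n)%N, connected_quandle Q, symmetric_quandle Q
      & ~ involutory_quandle Q].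
Proof.
have gt1_2n : (1 < 2 * n)%N by rewrite mul2n -addnn -addn1 leq_add.
pose c : 'Z_(2 * n) := n%:R.
exists ('Z_3 * 'Z_(2 * n))%type, (galkin c); split.
- by rewrite card_prod !card_ord (Zp_cast gt1_2n) mulnA.
- exact: galkin_connected.
- exists (fun p => (p.1, p.2 + c)); apply: galkin_good_involution.
  by rewrite -[RHS](pchar_Zp gt1_2n) natrM mulr_natl.
- apply: galkin_not_involutory; apply/eqP => /(congr1 val) /=.
  rewrite val_Zp_nat // modn_small; first by case: n hn {c gt1_2n}.
  by rewrite mul2n -addnn -[X in (X < _)%N]addn0 ltn_add2l.
Qed.
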